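(* Let $\sigma \in \mathcal{C}_q$ with $\operatorname{des}(\sigma)=d$ and let $k>d$ be an integer. Then, for every vector $\boldsymbol{n}=(n_1,\ldots,n_q)$ that is $\sigma$-admissible in degree $k$, there are $n_q$ realizations $(\mathbf{m}_k,\mathcal{O})$ of $\sigma$ with $\mathbf{fix}(\mathcal{O})=\boldsymbol{n}$. More precisely, for each integer $0 \leq n<n_q$ there is a unique realization $\mathcal{O}_n=\{x_1,\ldots,x_q\}$ of $\sigma$ under $\mathbf{m}_k$ with $\mathbf{fix}(\mathcal{O}_n)=\boldsymbol{n}$ and with exactly $n$ fixed points of $\mathbf{m}_k$ in $(0,x_1)$. As a result, these realizations are rotated copies of one another: $$\mathcal{O}_n=\mathcal{O}_0+\frac{n}{k-1} \pmod{\mathbb{Z}}, \qquad 0 \leq n<n_q.$$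
   Context: Fix an integer $q\ge 2$. $\mathcal{S}_q$ is the group of permutations of $\mathbb{Z}/q\mathbb{Z}$, whose elements are identified with their representatives in $\{1,\dots,q\}$ (indices are taken modulo $q$). $\mathcal{C}_q\subset\mathcal{S}_q$ is the set of $q$-cycles. Descent number: $\operatorname{des}(\sigma)=\#\{i\in\mathbb{Z}/q\mathbb{Z}:\sigma(i)>\sigma(i+1)\}$, where the inequality uses the linear order of the representatives $1,\dots,q$ and $i=q$ is included (comparing $\sigma(q)$ with $\sigma(1)$). One has $\operatorname{des}(\sigma)\ge 1$. For $a\ne b$ in $\mathbb{Z}/q\mathbb{Z}$, $[a,b)$ denotes the cyclic interval $\{a,a+1,\dots,b-1\}$ (mod $q$). The signature of $\sigma\in\mathcal{C}_q$ is $\mathbf{sig}(\sigma)=(a_1,\dots,a_q)$ where $a_i=1$ if $i\in[\sigma(i),\sigma(i+1))$ and $a_i=0$ otherwise. For an integer $k\ge2$, $\mathbf{m}_k:\mathbb{R}/\mathbb{Z}\to\mathbb{R}/\mathbb{Z}$ is $\mathbf{m}_k(x)=kx \pmod{\mathbb{Z}}$. Points of $\mathbb{R}/\mathbb{Z}$ are identified with their representatives in $[0,1)$. A period $q$ orbit is $\mathcal{O}=\{x_1,\dots,x_q\}$, with $q$ distinct points labeled so that $0<x_1<\dots<x_q<1$. $\mathcal{O}$ (or the pair $(\mathbf{m}_k,\mathcal{O})$) is a realization of $\sigma\in\mathcal{C}_q$ under $\mathbf{m}_k$ if $\mathbf{m}_k(x_i)=x_{\sigma(i)}$ for all $i$.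 The fixed point distribution of $\mathcal{O}$ is $\mathbf{fix}(\mathcal{O})=(n_1,\dots,n_q)$, where $n_i$ is the number of fixed points of $\mathbf{m}_k$ in the interior of the partition interval $I_i=[x_i,x_{i+1}]$ (counterclockwise arc of the circle; $I_q=[x_q,x_1]$ is the arc containing $0$). A non-negative integer vector $\boldsymbol{n}=(n_1,\dots,n_q)$ is $\sigma$-admissible in degree $k$ if $\sum_{i=1}^q n_i=k-1$, $n_q\ge1$, and $\boldsymbol{n}\ge\mathbf{sig}(\sigma)$ componentwise. *)

(* Defs.v *)
From HB Require Import structures.
From mathcomp Require Import all_boot all_order all_algebra all_fingroup.
From mathcomp Require Import all_classical all_reals.
Set Implicit Arguments.
Unset Strict Implicit.
Unset Printing Implicit Defensive.
Import Order.TTheory GRing.Theory Num.Theory.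
Local Open Scope classical_set_scope.
Local Open Scope card_scope.
Local Open Scope ring_scope.

(* Indices live in 'Z_q, which is Z/qZ for q >= 2.  The index written q in   *)
(* the literature is 0 : 'Z_q, and the linear order on indices is the one of *)
(* the representatives 1, ..., q; it is not the order of the ordinals.       *)
Definition rep (q : nat) (i : 'Z_q) : nat :=
  if i == 0 then q else nat_of_ord i.

Definition q_cycle (q : nat) (sigma : {perm 'Z_q}) : Prop :=
  forall i : 'Z_q, porbit sigma i = [set: 'Z_q]%SET.

Definition des (q : nat) (sigma : {perm 'Z_q}) : nat :=
  #|[set i : 'Z_q | (rep (sigma (i + 1)%R) < rep (sigma i))%N]%SET|.

(* [a, b) = {a, a + 1, ..., b - 1} modulo q: the differences are taken in    *)
(* 'Z_q and compared through their representatives in 0, ..., q - 1.         *)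
Definition cyclic_itv (q : nat) (a b : 'Z_q) : {set 'Z_q} :=
  [set i : 'Z_q | (nat_of_ord (i - a)%R < nat_of_ord (b - a)%R)%N]%SET.

Definition sig (q : nat) (sigma : {perm 'Z_q}) (i : 'Z_q) : nat :=
  if i \in cyclic_itv (sigma i) (sigma (i + 1)) then 1%N else 0%N.

Definition admissible (q : nat) (sigma : {perm 'Z_q}) (k : nat)
    (n : 'Z_q -> nat) : Prop :=
  [/\ (\sum_(i : 'Z_q) n i)%N = k.-1,
      (1 <= n 0%R)%N
    & forall i : 'Z_q, (sig sigma i <= n i)%N].

(* Points of R/Z are represented by elements of [0, 1). *)
Definition modZ (R : realType) (x : R) : R := x - (Num.floor x)%:~R.

Definition mulmap (R : realType) (k : nat) (x : R) : R := modZ (k%:R * x).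

Definition fixpts (R : realType) (k : nat) : set R :=
  [set t | 0 <= t < 1 /\ mulmap k t = t].

(* x is the labeling 0 < x_1 < ... < x_q < 1 of the points of O. *)
Definition labeling (R : realType) (q : nat) (x : 'Z_q -> R) (O : set R) :
    Prop :=
  [/\ O = range x,
      forall i : 'Z_q, 0 < x i < 1
    & forall i j : 'Z_q, (rep i < rep j)%N -> x i < x j].

(* That the q points are distinct is part of labeling. *)
Definition periodic_orbit (R : realType) (k q : nat) (O : set R) : Prop :=
  exists t : R, [/\ 0 <= t < 1, iter q (mulmap k) t = t
    & O = [set iter j (mulmap k) t | j in `I_q]].

Definition realization (R : realType) (q k : nat) (sigma : {perm 'Z_q})
    (O : set R) : Prop :=
  periodic_orbit k q O /\
  exists2 x : 'Z_q -> R, labeling x O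
    & forall i : 'Z_q, mulmap k (x i) = x (sigma i).

(* Interior of I_i = [x_i, x_(i+1)]; for i = q it is the arc through 0. *)
Definition open_arc (R : realType) (q : nat) (x : 'Z_q -> R) (i : 'Z_q) :
    set R :=
  [set t | 0 <= t < 1 /\
    (if i == 0 then x 0 < t \/ t < x 1 else x i < t /\ t < x (i + 1))].

(* fix(O) = n *)
Definition has_fix (R : realType) (q k : nat) (O : set R) (n : 'Z_q -> nat) :
    Prop :=
  exists2 x : 'Z_q -> R, labeling x O
    & forall i : 'Z_q, fixpts k `&` open_arc x i #= `I_(n i).

(* There are exactly m fixed points in (0, x_1). *)
Definition has_fix_before (R : realType) (q k : nat) (O : set R) (m : nat) :
    Prop :=
  exists2 x : 'Z_q -> R, labeling x O
    & fixpts k `&` [set t | 0 < t < x 1] #= `I_m.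

(* Main.v *)
Require Import Defs.
From HB Require Import structures.
From mathcomp Require Import all_boot all_order all_algebra all_fingroup.
From mathcomp Require Import all_classical all_reals.
From mathcomp Require Import zify lra.
Set Implicit Arguments.
Unset Strict Implicit.
Unset Printing Implicit Defensive.
Import Order.TTheory GRing.Theory Num.Theory.
Local Open Scope classical_set_scope.
Local Open Scope card_scope.
Local Open Scope ring_scope.

(** Let x_1 < ... < x_q be the labeled points of a realization and write
    k x_i = x_(sigma i) + e_i with e_i a natural number.  Subtracting x_i,
    (k-1) x_i = (x_(sigma i) - x_i) + e_i, and the difference in parentheses
    lies strictly between -1 and 1 and has the sign of sigma i - i.  Hence

      e_i = c_i + [sigma i < i]   where  c_i = floor ((k-1) x_i).

    The fixed points of multiplication by k are the j/(k-1), so c_i counts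
    those in (0, x_i]; therefore the fixed point distribution is n exactly when
    c_(i+1) = c_i + n_i for 1 <= i < q, and c_1 is the number of fixed points
    in (0, x_1).  So n and m = c_1 determine c, hence e ([floors], [code]), and
    e determines x, since k x_i = x_(sigma i) + e_i is an expanding linear
    system ([solves_unique]).  Counting on the arc through 0 gives
    n_q = k - 1 - c_q + c_1 with c_q < k - 1, which forces m < n_q.  This
    proves uniqueness ([realization_orbit_of]).

    For existence, one solves the system for the code of n and m: x_i is the
    point whose base k expansion is e_i, e_(sigma i), e_(sigma^2 i), and so on.
    The required order of the points comes from

      sig_i + [sigma (i+1) < i+1] = [sigma (i+1) < sigma i] + [sigma i < i],

    an identity on cyclic intervals ([sig_rep]).  Together with n_i >= sig_i it
    says that e is nondecreasing and increases at each descent of sigma, so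
    that e_i = e_j with i < j implies sigma i < sigma j ([code_compatible]).
    The expansions are then in increasing lexicographic order, strictly because
    sigma is a single cycle.  This comparison is carried out without infinite
    expansions, by looking at a pair i < j that minimizes x_j - x_i
    ([min_principle], [solves_increasing]).

    Raising m by one raises every e_i by one, which shifts the solution of the
    system by 1/(k-1); this is the rotation statement. *)

(** * Representatives 1, ..., q of the residues *)

Lemma rep_itv q (i : 'Z_q) : (1 < q)%N -> (0 < rep i <= q)%N.
Proof.
case: q i => [|[|q]] // i _; rewrite /rep; case: eqVneq => [_|i0].
  by rewrite leqnn.
by rewrite lt0n i0 /= ltnW ?ltn_ord.
Qed.

Lemma rep0 q : rep (0 : 'Z_q) = q.
Proof. by rewrite /rep eqxx. Qed.

Lemma rep1 q : (1 < q)%N -> rep (1 : 'Z_q) = 1%N.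
Proof. by case: q => [|[|q]]. Qed.

Lemma rep_natr q a : (0 < a <= q)%N -> (1 < q)%N -> rep (a%:R : 'Z_q) = a.
Proof.
case: q => [|[|q]] //; rewrite /rep Zp_nat -val_eqE /= => /andP[a0 aq] _.
move: aq; rewrite leq_eqVlt => /predU1P[->|aq]; first by rewrite modnn eqxx.
by rewrite modn_small // eqn0Ngt a0.
Qed.

Lemma natr_rep q (i : 'Z_q) : (1 < q)%N -> (rep i)%:R = i.
Proof.
case: q i => [|[|q]] // i _; rewrite /rep Zp_nat; apply: val_inj.
by case: eqVneq => [->|i0] /=; rewrite ?modnn // modn_small // ltn_ord.
Qed.

Lemma rep_inj q : (1 < q)%N -> injective (@rep q).
Proof. by move=> hq i j eij; rewrite -(natr_rep i) // eij natr_rep. Qed.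

Lemma rep_lt0 q (i : 'Z_q) : (1 < q)%N -> (rep i < q)%N = (i != 0).
Proof.
move=> hq; have /andP[_ iq] := rep_itv i hq.
by rewrite ltn_neqAle iq andbT -{2}(rep0 q) (inj_eq (rep_inj hq)).
Qed.

Lemma repS q (i : 'Z_q) : (1 < q)%N -> i != 0 -> rep (i + 1) = (rep i).+1.
Proof.
by move=> hq i0; rewrite -{1}(natr_rep i hq) -mulrSr rep_natr ?rep_lt0.
Qed.

Lemma repB q (i a : 'Z_q) : (1 < q)%N ->
  nat_of_ord (i - a)
  = (if rep a <= rep i then rep i - rep a else rep i + q - rep a)%N.
Proof.
move=> hq; have /andP[ai aq] := rep_itv a hq; have /andP[ii iq] := rep_itv i hq.
case: ifP => [le_ai|/negbT]; last rewrite -ltnNge => lt_ia.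
  rewrite -{1}(natr_rep i hq) -{1}(natr_rep a hq) -natrB // val_Zp_nat //.
  by rewrite modn_small //; lia.
have -> : i - a = (rep i + q - rep a)%:R.
  rewrite natrB ?natrD; last lia.
  by rewrite !natr_rep // pchar_Zp // addr0.
by rewrite val_Zp_nat // modn_small //; lia.
Qed.

(** * Cyclic permutations *)

Section Cycle.
Variables (q : nat) (sigma : {perm 'Z_q}).
Hypotheses (hq : (1 < q)%N) (hsigma : q_cycle sigma).

Lemma q_cycle_ind (P : 'Z_q -> Prop) (i : 'Z_q) :
  P i -> (forall j, P j -> P (sigma j)) -> forall j, P j.
Proof.
move=> Pi PS j; have : j \in porbit sigma i by rewrite hsigma inE.
case/porbitP => l ->; elim: l => [|l IH]; first by rewrite expg0 perm1.
by rewrite expgSr permM; exact: PS.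
Qed.

Lemma q_cycle_neq (i : 'Z_q) : sigma i != i.
Proof.
apply/eqP => si.
have all_i j : j = i by apply: (@q_cycle_ind (fun j => j = i) i) => // l ->.
by have := oner_neq0 'Z_q; rewrite (all_i 1) -(all_i 0) eqxx.
Qed.

Lemma q_cycle_order (i : 'Z_q) : iter q sigma i = i.
Proof.
have := iter_porbit sigma i.
by rewrite hsigma cardsT card_ord [X in iter X](Zp_cast hq).
Qed.

Lemma q_cycle_iter (i j : 'Z_q) : exists2 l, (l < q)%N & j = iter l sigma i.
Proof.
have : j \in porbit sigma i by rewrite hsigma inE.
rewrite porbit_traject hsigma cardsT card_ord => /trajectP[l lq ->].
by exists l; rewrite // (leq_trans lq) // (Zp_cast hq).
Qed.

(** This is where the signature enters.  Travelling forward from sigma i to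
    sigma (i + 1), one passes the wrap-around from q to 1 exactly at a descent;
    the positions of the two ends, below or above the step from i to i + 1,
    then tell whether that step was met on the way.  The case i = q is
    excluded, as there the step from i to i + 1 itself wraps around. *)
Lemma sig_rep (i : 'Z_q) : i != 0 ->
  (sig sigma i + (rep (sigma (i + 1)%R) < rep (i + 1)%R)
   = (rep (sigma (i + 1)%R) < rep (sigma i)) + (rep (sigma i) < rep i))%N.
Proof.
move=> i0; have si := repS hq i0.
have n1 := q_cycle_neq i; have n2 := q_cycle_neq (i + 1).
have n3 : sigma i != sigma (i + 1).
  by rewrite (inj_eq perm_inj) -(inj_eq (rep_inj hq)) si; lia.
move: n1 n2 n3; rewrite -!(inj_eq (rep_inj hq)) si.
rewrite /sig /cyclic_itv inE !repB //.
move: (rep_itv (sigma i) hq) (rep_itv (sigma (i + 1)) hq) (rep_itv i hq).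
move: (rep i) (rep (sigma i)) (rep (sigma (i + 1))) => a b c.
case: (leqP b a); case: (leqP b c); case: (ltnP c b); case: (ltnP c a.+1);
  case: (ltnP b a); case: ifP; lia.
Qed.

End Cycle.

(** * Itineraries *)

(** A digit sequence e along which the orbit order is consistent: e is
    nondecreasing, and strictly increases between i and j whenever sigma
    reverses their order, so that ties of first digits are never broken the
    wrong way by the remaining digits. *)
Definition compatible q (sigma : {perm 'Z_q}) (e : 'Z_q -> nat) : Prop :=
  forall i j : 'Z_q, (rep i < rep j)%N ->
    (e i + (rep (sigma j) < rep (sigma i)) <= e j)%N.

(** The index q is above all others, so the predecessor of q in the cycle and q
    itself have their order reversed by sigma, hence different digits. *)
Lemma compatible_not_const q (sigma : {perm 'Z_q}) e :
  (1 < q)%N -> q_cycle sigma -> compatible sigma e -> exists i, e i != e 0.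
Proof.
move=> hq hsigma he; have s0 := q_cycle_neq hsigma 0.
pose i : 'Z_q := (sigma^-1)%g 0; have si : sigma i = 0 by rewrite permKV.
have i0 : i != 0 by rewrite -(inj_eq (@perm_inj _ sigma)) si eq_sym.
exists i; have := he i 0; rewrite si rep0 !rep_lt0 // i0 s0 => /(_ isT).
by rewrite addn1 => /ltn_eqF->.
Qed.

(** The value forced on floor ((k-1) x_i) by the fixed point counts n and by the
    presence of m fixed points before x_1. *)
Definition floors q (n : 'Z_q -> nat) (m : nat) (i : 'Z_q) : nat :=
  (m + \sum_(1 <= j < rep i) n j%:R)%N.

(** The digit floor (k x_i) of a realization; it exceeds floor ((k-1) x_i) by
    one exactly when the point moves to the left. *)
Definition code q (sigma : {perm 'Z_q}) (n : 'Z_q -> nat) (m : nat)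
    (i : 'Z_q) : nat :=
  (floors n m i + (rep (sigma i) < rep i))%N.

Lemma floors1 q (n : 'Z_q -> nat) m : (1 < q)%N -> floors n m 1 = m.
Proof. by move=> hq; rewrite /floors rep1 // big_geq ?addn0. Qed.

Lemma floorsS q (n : 'Z_q -> nat) m (i : 'Z_q) : (1 < q)%N -> i != 0 ->
  floors n m (i + 1) = (floors n m i + n i)%N.
Proof.
move=> hq i0; have /andP[ri _] := rep_itv i hq.
by rewrite /floors repS // big_nat_recr //= natr_rep // addnA.
Qed.

(** One full turn: floors starts again from m at index 1, so the jump n_q over
    the arc through 0 shows only in the total. *)
Lemma floors0 q (n : 'Z_q -> nat) m : (1 < q)%N ->
  (floors n m 0%R + n 0%R = m + \sum_i n i)%N.
Proof.
move=> hq; rewrite /floors rep0 -addnA; congr addn.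
transitivity (\sum_(0 <= j < (Zp_trunc q).+2) n j%:R)%N.
  by rewrite [X in index_iota 0 X](Zp_cast hq) [RHS]big_ltn 1?ltnW // addnC.
rewrite big_mkord; apply: eq_bigr => i _.
by rewrite natr_Zp.
Qed.

Lemma floors_unique q (n c : 'Z_q -> nat) : (1 < q)%N ->
  (forall i : 'Z_q, i != 0%R -> c (i + 1)%R = c i + n i)%N ->
  c =1 floors n (c 1%R).
Proof.
move=> hq cS i; rewrite -(natr_rep i hq); have := rep_itv i hq.
elim: (rep i) => // -[|a] IH; first by rewrite floors1.
move=> /andP[_ aq]; have ra : rep (a.+1%:R : 'Z_q) = a.+1.
  by rewrite rep_natr //= ltnW.
have a0 : a.+1%:R != 0 :> 'Z_q by rewrite -rep_lt0 // ra.
by rewrite [a.+2%:R]mulrSr cS // floorsS // IH //= ltnW.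
Qed.

Section AdmissibleCode.
Variables (q k : nat) (sigma : {perm 'Z_q}) (n : 'Z_q -> nat).
Hypotheses (hq : (1 < q)%N) (hsigma : q_cycle sigma).
Hypothesis (hn : admissible sigma k n).

Lemma admissible_degree : (1 < k)%N.
Proof.
case: hn => ns n0 _; rewrite ltnNge; apply/negP => k1.
move: ns; rewrite (_ : k.-1 = 0)%N; last by case: k k1 => [|[|]].
move/eqP; rewrite sum_nat_eq0 => /forallP/(_ 0).
by rewrite -leqn0 leqNgt n0.
Qed.

(** One step is [sig_rep] combined with n_i >= sig_i; longer gaps follow because
    an inversion of sigma between i and j requires a descent in between. *)
Lemma code_compatible m : compatible sigma (code sigma n m).
Proof.
have step (i : 'Z_q) : i != 0 ->
    (code sigma n m i + (rep (sigma (i + 1)%R) < rep (sigma i))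
     <= code sigma n m (i + 1)%R)%N.
  move=> i0; have := sig_rep hq hsigma i0; case: hn => _ _ /(_ i).
  rewrite /code floorsS //.
  by do 3!case: (rep _ < _)%N; lia.
suff run : forall (a : nat) (i : 'Z_q), (rep i + a.+1 <= q)%N ->
    (code sigma n m i
       + (rep (sigma (rep i + a.+1)%:R) < rep (sigma i))
     <= code sigma n m (rep i + a.+1)%:R)%N.
  move=> i j ij; have /andP[_ jq] := rep_itv j hq.
  have := run (rep j - rep i).-1 i; rewrite prednK ?subn_gt0 // (subnKC (ltnW ij)).
  by rewrite natr_rep //; apply.
elim=> [|a IH] i iq.
  have i0 : i != 0 by rewrite -rep_lt0 //; lia.
  by rewrite addn1 mulrSr natr_rep //; exact: step.
have {IH} := IH i; rewrite !addnS in iq *; rewrite (ltnW iq) => /(_ isT) IH.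
have /andP[ri _] := rep_itv i hq.
set j : 'Z_q := (rep i + a).+1%:R in IH.
have j0 : j != 0 by rewrite -rep_lt0 // rep_natr //; lia.
have := step _ j0; rewrite [(rep i + a).+2%:R]mulrSr -/j.
move: IH; move: (code _ _ _ i) (code _ _ _ j) (code _ _ _ (j + 1)) => ei ej es.
by move: (rep (sigma i)) (rep (sigma j)) (rep (sigma (j + 1))) => a1 a2 a3; lia.
Qed.

(** By monotonicity it suffices to bound the digit of index q, and there
    floors + n_q = m + k - 1: this is where m < n_q is needed. *)
Lemma code_lt m (i : 'Z_q) : (m < n 0%R)%N -> (code sigma n m i < k)%N.
Proof.
move=> mn; have hk := admissible_degree; have := floors0 n m hq.
case: hn => -> _ _ e0.
suff : (code sigma n m i <= (floors n m 0%R).+1)%N by lia.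
have c0 : code sigma n m 0 = (floors n m 0).+1.
  by rewrite /code rep0 rep_lt0 // (q_cycle_neq hsigma) addn1.
rewrite -c0; have [->//|i0] := eqVneq i 0.
have := @code_compatible m i 0; rewrite rep0 rep_lt0 // => /(_ i0); lia.
Qed.

End AdmissibleCode.

(** * Points with a prescribed itinerary *)

(** If every negative value of a function on a finite set comes with another at
    least k > 1 times as negative, there is none: look at the minimum.  It stands
    in for comparing infinite base k expansions. *)
Lemma min_principle (R : realType) (T : finType) (P : pred T) (f : T -> R)
    (k : R) : 1 < k ->
  (forall t, P t -> f t < 0 -> exists2 s, P s & f s <= k * f t) ->
  forall t, P t -> 0 <= f t.
Proof.
move=> k1 step t Pt; case: (arg_minP f Pt) => t0 Pt0 min.
apply: le_trans (min t Pt); rewrite leNgt; apply/negP => neg.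
have [s Ps fs] := step _ Pt0 neg; have := min s Ps; nra.
Qed.

(** The points x_i with digits e_i; the equation is the one that
    multiplication by k satisfies before reduction modulo 1. *)
Definition solves (R : realType) (q k : nat) (sigma : {perm 'Z_q})
    (e : 'Z_q -> nat) (x : 'Z_q -> R) : Prop :=
  forall i, k%:R * x i = x (sigma i) + (e i)%:R.

Definition increasing (R : realType) (q : nat) (x : 'Z_q -> R) : Prop :=
  forall i j : 'Z_q, (rep i < rep j)%N -> x i < x j.

(** The number with base k digits e_i, e_(sigma i), ..., e_(sigma^(l-1) i). *)
Fixpoint word q (sigma : {perm 'Z_q}) (e : 'Z_q -> nat) (k l : nat)
    (i : 'Z_q) : nat :=
  if l is l'.+1 then (k * word sigma e k l' i + e (iter l' sigma i))%N else 0.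

(** The value of the purely periodic expansion of period q: a repeated block w
    of length q is worth w / (k^q - 1). *)
Definition point (R : realType) q (sigma : {perm 'Z_q}) (e : 'Z_q -> nat)
    (k : nat) (i : 'Z_q) : R :=
  (word sigma e k q i)%:R / (k%:R ^+ q - 1).

Section Solutions.
Variables (R : realType) (q k : nat) (sigma : {perm 'Z_q}) (e : 'Z_q -> nat).
Hypotheses (hq : (1 < q)%N) (hk : (1 < k)%N) (hsigma : q_cycle sigma).

Lemma solves_unique (x y : 'Z_q -> R) :
  solves k sigma e x -> solves k sigma e y -> x =1 y.
Proof.
have k1 : 1 < k%:R :> R by rewrite ltr1n.
have half (u v : 'Z_q -> R) : solves k sigma e u -> solves k sigma e v ->
    forall i, u i <= v i.
  move=> su sv i; rewrite -subr_ge0.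
  apply: (@min_principle R _ predT (fun i => v i - u i) _ k1) => // j _ _.
  by exists (sigma j) => //; rewrite mulrBr su sv; lra.
by move=> sx sy i; apply/le_anti; rewrite !half.
Qed.

Lemma word_first l (i : 'Z_q) :
  word sigma e k l.+1 i = (k ^ l * e i + word sigma e k l (sigma i))%N.
Proof.
elim: l => [|l IH]; first by rewrite /= muln0 mul1n addn0.
by rewrite -[LHS]/(k * word sigma e k l.+1 i + e (iter l.+1 sigma i))%N IH
  mulnDr mulnA -expnS -addnA iterSr.
Qed.

(** The word of length q+1 read from i can be split off at its first digit or at
    its last one; the two digits agree as sigma has order q. *)
Lemma point_solves : solves k sigma e (point R sigma e k).
Proof.
move=> i; have kq : k%:R ^+ q - 1 != 0 :> R.
  by rewrite subr_eq0 gt_eqF // exprn_egt1 ?ltr1n //; lia.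
have := word_first q i; rewrite /= (q_cycle_order hq hsigma).
move/(congr1 (fun a => a%:R : R)); rewrite !natrD !natrM natrX => eqw.
by rewrite /point; apply: (mulIf kq); rewrite mulrDl -mulrA !divfK //; lra.
Qed.

Hypotheses (he : compatible sigma e) (ek : forall i, (e i < k)%N).

(** The bounds 0 <= x <= 1 hold by the minimum principle.  If some x_i is 0 or 1
    then its digit is extremal and x_(sigma i) has the same value; this spreads
    to the whole cycle and makes e constant. *)
Lemma solves_itv (x : 'Z_q -> R) : solves k sigma e x -> forall i, 0 < x i < 1.
Proof.
move=> sx; have k1 : 1 < k%:R :> R by rewrite ltr1n.
have [i0 ei0] := compatible_not_const hq hsigma he.
have x_ge0 i : 0 <= x i.
  apply: (@min_principle R _ predT x _ k1) => // j _ _.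
  by exists (sigma j) => //; rewrite sx lerDl.
have x_le1 i : x i <= 1.
  rewrite -subr_ge0.
  apply: (@min_principle R _ predT (fun i => 1 - x i) _ k1) => // j _ _.
  exists (sigma j) => //; rewrite mulrBr sx.
  have : (e j)%:R + 1 <= k%:R :> R by rewrite natr1 ler_nat.
  lra.
move=> i; rewrite !lt_neqAle x_ge0 x_le1 !andbT eq_sym; apply/andP; split.
- apply: contra ei0 => /eqP xi.
  have all0 : forall j, x j = 0.
    apply: (q_cycle_ind hsigma xi) => j xj; have := sx j.
    by have := ler0n R (e j); have := x_ge0 (sigma j); rewrite xj; lra.
  rewrite -(eqr_nat R); have := sx i0; have := sx 0; rewrite !all0; lra.
- apply: contra ei0 => /eqP xi.
  have all1 : forall j, x j = 1.
    apply: (q_cycle_ind hsigma xi) => j xj; have := sx j.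
    have : (e j)%:R + 1 <= k%:R :> R by rewrite natr1 ler_nat.
    by have := x_le1 (sigma j); rewrite xj; lra.
  rewrite -(eqr_nat R); have := sx i0; have := sx 0; rewrite !all1; lra.
Qed.

(** If x_j <= x_i with i < j, then the digits are equal and sigma i < sigma j
    ([next] below), so the same comparison occurs at the images with a gap
    multiplied by k.  A negative gap is thus impossible by the minimum
    principle, and a zero gap would travel along the cycle until i becomes the
    largest index q. *)
Lemma solves_increasing (x : 'Z_q -> R) : solves k sigma e x -> increasing x.
Proof.
move=> sx; have k1 : 1 < k%:R :> R by rewrite ltr1n.
have itv := solves_itv sx.
have next i j : (rep i < rep j)%N -> x j <= x i ->
    (rep (sigma i) < rep (sigma j))%N /\ e i = e j.
  move=> ij xij; have le_e := he ij.
  have eij : e i = e j.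
    apply/eqP; rewrite eqn_leq (leq_trans (leq_addr _ _) le_e) /= leqNgt.
    apply/negP => lt_e.
    have : (e i)%:R + 1 <= (e j)%:R :> R by rewrite natr1 ler_nat.
    have := sx i; have := sx j; have := itv (sigma i); have := itv (sigma j).
    nra.
  split=> //; move: le_e; rewrite eij -{2}[e j]addn0 leq_add2l leqn0 eqb0.
  rewrite -leqNgt leq_eqVlt (inj_eq (rep_inj hq)) (inj_eq perm_inj).
  by case/predU1P => // ij'; rewrite ij' ltnn in ij.
have weak i j : (rep i < rep j)%N -> x i <= x j.
  move=> ij; rewrite -subr_ge0.
  apply: (@min_principle R _ (fun p : 'Z_q * 'Z_q => (rep p.1 < rep p.2)%N)
    (fun p => x p.2 - x p.1) _ k1 _ (i, j)) => //= -[a b] /= ab xab.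
  have [|sab eab] := next _ _ ab; first by lra.
  by exists (sigma a, sigma b) => //=; rewrite mulrBr !sx eab; lra.
move=> i j ij; rewrite lt_neqAle weak // andbT; apply/eqP => xij.
have : exists2 b : 'Z_q, (rep (0%R : 'Z_q) < rep b)%N & x 0 = x b.
  apply: (@q_cycle_ind _ _ hsigma
    (fun a => exists2 b : 'Z_q, (rep a < rep b)%N & x a = x b) i).
    by exists j.
  move=> a [b ab xab]; have [|sab eab] := next _ _ ab; first by rewrite xab.
  by exists (sigma b) => //; have := sx a; have := sx b; rewrite xab eab; lra.
case=> b; rewrite rep0 => qb _; have /andP[_] := rep_itv b hq.
by rewrite leqNgt qb.
Qed.

End Solutions.

(** * Counting fixed points *)

Lemma modZ_id (R : realType) (x : R) : 0 <= x < 1 -> modZ x = x.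
Proof. by move=> x01; rewrite /modZ (@floor_def _ _ 0) ?subr0. Qed.

Lemma mulmapP (R : realType) (k : nat) (x y : R) : 0 <= x -> 0 <= y < 1 ->
  mulmap k x = y <-> exists e : nat, k%:R * x = y + e%:R.
Proof.
move=> x0 y01; rewrite /mulmap /modZ; split=> [<-|[e ->]].
  exists `|Num.floor (k%:R * x)|%N; rewrite natr_absz ger0_norm ?subrK //.
  by rewrite floor_ge0 mulr_ge0.
by rewrite (@floor_def _ _ e%:Z) ?addrK //= intrD -pmulrn; lra.
Qed.

Lemma fixptsP (R : realType) (k : nat) (t : R) : (1 < k)%N ->
  fixpts k t <-> exists2 j, (j < k.-1)%N & t = j%:R / k.-1%:R.
Proof.
case: k => // k; rewrite ltnS /= => k0; have kR : 0 < k%:R :> R by rewrite ltr0n.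
split=> [[t01]|[j jk ->]].
  have /andP[t0 t1] := t01; case/(mulmapP _ t0 t01) => j; rewrite -natr1 => tj.
  have tk : t = j%:R / k%:R by apply: (canRL (mulfK (lt0r_neq0 kR))); lra.
  exists j => //; rewrite -(ltr_nat R); move: t1.
  by rewrite tk ltr_pdivrMr // mul1r.
have t01 : 0 <= (j%:R / k%:R : R) < 1.
  by rewrite divr_ge0 //= ltr_pdivrMr // mul1r ltr_nat.
split=> //; have /andP[t0 _] := t01; apply/(mulmapP _ t0 t01).
by exists j; rewrite -natr1 mulrDl mulrC divfK ?gt_eqF // mul1r addrC.
Qed.

(** Fixed points are counted by a parametrization j = g l of the numerators; g
    absorbs the offset of an ordinary arc and the missing middle part of the
    arc through 0. *)
Lemma card_fixpts (R : realType) (k N : nat) (A : set R) (g : nat -> nat) :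
  (1 < k)%N -> injective g -> (forall l, (l < N)%N -> (g l < k.-1)%N) ->
  (forall j, (j < k.-1)%N ->
     A (j%:R / k.-1%:R) <-> exists2 l, (l < N)%N & j = g l) ->
  fixpts k `&` A #= `I_N.
Proof.
move=> hk ginj gk gA; have kR : k.-1%:R != 0 :> R by rewrite pnatr_eq0; lia.
have -> : fixpts k `&` A = [set (g l)%:R / k.-1%:R | l in `I_N].
  apply/seteqP; split=> [t [/(fixptsP _ hk)[j jk ->]]|_ [l lN <-]].
    by case/(gA _ jk) => l lN ->; exists l.
  split; first by apply/fixptsP => //; exists (g l) => //; exact: gk.
  by apply/gA; [exact: gk|exists l].
apply: inj_card_eq => l l' _ _ /(mulIf _) => /(_ (invr_neq0 kR)) /eqP.
by rewrite eqr_nat => /eqP/ginj.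
Qed.

Section Count.
Variables (R : realType) (q k : nat) (x : 'Z_q -> R) (c : 'Z_q -> nat).
Hypotheses (hq : (1 < q)%N) (hk : (1 < k)%N).
Hypotheses (x01 : forall i, 0 < x i < 1) (xlt : increasing x).
Hypothesis (hc : forall i, (c i)%:R < k.-1%:R * x i < (c i)%:R + 1).

Let kR : 0 < k.-1%:R :> R. Proof. by rewrite ltr0n -ltnS prednK // ltnW. Qed.

Lemma floor_le (i j : 'Z_q) : (rep i <= rep j)%N -> (c i <= c j)%N.
Proof.
rewrite leq_eqVlt (inj_eq (rep_inj hq)) => /predU1P[->//|/xlt xij].
rewrite -ltnS -(ltr_nat R) -natr1; have := hc i; have := hc j.
have : k.-1%:R * x i < k.-1%:R * x j by rewrite ltr_pM2l.
lra.
Qed.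

Lemma floor_lt_degree (i : 'Z_q) : (c i < k.-1)%N.
Proof.
rewrite -(ltr_nat R); have := hc i; have /andP[_ x1] := x01 i.
have : k.-1%:R * x i < k.-1%:R * 1 by rewrite ltr_pM2l.
lra.
Qed.

Lemma lt_fixpt (i : 'Z_q) j : x i < j%:R / k.-1%:R <-> (c i < j)%N.
Proof.
rewrite ltr_pdivlMr // mulrC; have /andP[h1 h2] := hc i; split=> h.
  by rewrite -(ltr_nat R) (lt_trans h1).
by apply: lt_le_trans h2 _; rewrite natr1 ler_nat.
Qed.

Lemma fixpt_lt (i : 'Z_q) j : j%:R / k.-1%:R < x i <-> (j <= c i)%N.
Proof.
rewrite ltr_pdivrMr // mulrC; have /andP[h1 h2] := hc i; split=> h.
  by rewrite -ltnS -(ltr_nat R) -natr1 (lt_trans h).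
by apply: le_lt_trans h1; rewrite ler_nat.
Qed.

Let fixpt_itv j : (j < k.-1)%N -> 0 <= (j%:R / k.-1%:R : R) < 1.
Proof. by move=> jk; rewrite divr_ge0 //= ltr_pdivrMr // mul1r ltr_nat. Qed.

Lemma card_arc (i : 'Z_q) : i != 0 ->
  fixpts k `&` open_arc x i #= `I_(c (i + 1)%R - c i).
Proof.
move=> i0; have := @floor_le i (i + 1); rewrite repS // => /(_ (leqnSn _)).
move: (floor_lt_degree (i + 1)) (lt_fixpt i) (fixpt_lt (i + 1)).
move: (c i) (c (i + 1)) => a b bk ltP gtP ab.
apply: (@card_fixpts _ _ _ _ (fun l => a.+1 + l)%N) => //.
- exact: addnI.
- by move=> l; lia.
move=> j jk; rewrite /open_arc /= (negPf i0); split.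
  move=> [_ [/ltP h1 /gtP h2]]; exists (j - a.+1)%N; lia.
move=> [l lN jl]; split; first exact: fixpt_itv.
by split; [apply/ltP|apply/gtP]; lia.
Qed.

(** The fixed point 0 lies in this arc, and its k - 1 - (c_q - c_1) fixed points
    are the complement of those between x_1 and x_q. *)
Lemma card_arc0 : fixpts k `&` open_arc x 0 #= `I_(k.-1 - (c 0%R - c 1%R)).
Proof.
have := @floor_le 1 0; rewrite rep0 rep1 // => /(_ (ltnW hq)).
move: (floor_lt_degree 0) (lt_fixpt 0) (fixpt_lt 1).
move: (c 0) (c 1) => b a bk ltP gtP ab.
(* Numerators up to a lie before x_1; the next one on the arc is b + 1. *)
pose g l := if (l <= a)%N then l else (l + (b - a))%N.
apply: (@card_fixpts _ _ _ _ g) => //.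
- by move=> l l'; rewrite /g; case: (leqP l a); case: (leqP l' a); lia.
- by move=> l; rewrite /g; case: (leqP l a); lia.
move=> j jk; rewrite /open_arc /=; split.
  move=> [_ [/ltP h|/gtP h]].
    by exists (j - (b - a))%N; rewrite /g; first lia; case: (leqP _ a); lia.
  by exists j; rewrite /g ?h //; lia.
move=> [l lN jl]; split; first exact: fixpt_itv.
move: jl; rewrite /g; case: (leqP l a) => h jl.
  by right; apply/gtP; rewrite jl.
by left; apply/ltP; lia.
Qed.

(** Only the numerators 1, ..., c_1 count, since 0 is excluded. *)
Lemma card_before : fixpts k `&` [set t | 0 < t < x 1] #= `I_(c 1%R).
Proof.
have ck := floor_lt_degree 1.
apply: (@card_fixpts _ _ _ _ succn) => //.
- by move=> l l' [].
- by move=> l /leq_ltn_trans; apply.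
move=> j jk /=; split.
  move=> /andP[j0 /fixpt_lt jc].
  have j1 : (0 < j)%N.
    by rewrite lt0n; apply: contraTneq j0 => ->; rewrite mul0r ltxx.
  by exists j.-1; rewrite prednK.
move=> [l lc ->]; apply/andP; split; first by rewrite divr_gt0.
exact/fixpt_lt.
Qed.

End Count.

(** * Realizations *)

(** If y_i = x_(f i), then f is a strictly increasing self-map of 1, ..., q, so
    f i >= i. *)
Lemma increasing_le (R : realType) q (x y : 'Z_q -> R) : (1 < q)%N ->
  increasing x -> increasing y -> range y `<=` range x ->
  forall i, x i <= y i.
Proof.
move=> hq xlt ylt yx i.
have /choice[f fE] : forall j, exists l, x l = y j.
  by move=> j; have [|l _] := yx (y j); [exists j|exists l].
have flt j l : (rep j < rep l)%N -> (rep (f j) < rep (f l))%N.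
  move=> /ylt; rewrite -!fE => fjl; rewrite ltnNge; apply/negP.
  rewrite leq_eqVlt (inj_eq (rep_inj hq)) => /predU1P[elj|/xlt].
    by rewrite elj ltxx in fjl.
  by move/(lt_trans fjl); rewrite ltxx.
have : (rep i <= rep (f i))%N.
  rewrite -{2}(natr_rep i hq); have := rep_itv i hq.
  elim: (rep i) => // -[|a] IH; first by have /andP[] := rep_itv (f 1) hq.
  move=> /andP[_ aq]; apply: leq_ltn_trans (IH _) (flt _ _ _).
    by rewrite /= ltnW.
  by rewrite !rep_natr //= ltnW.
rewrite -fE leq_eqVlt (inj_eq (rep_inj hq)) => /predU1P[<-//|/xlt].
exact: ltW.
Qed.

Lemma labeling_unique (R : realType) q (x y : 'Z_q -> R) (O : set R) :
  (1 < q)%N -> labeling x O -> labeling y O -> x = y.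
Proof.
move=> hq [xO _ xlt] [yO _ ylt]; apply/funext => i; apply/le_anti.
by rewrite !increasing_le // -xO yO.
Qed.

Lemma card_II_unique T (A : set T) a b : A #= `I_a -> A #= `I_b -> a = b.
Proof.
by move=> Aa Ab; apply/card_eq_II; apply: card_eq_trans Ab; rewrite card_eq_sym.
Qed.

Section Realizations.
Variables (R : realType) (q k : nat) (sigma : {perm 'Z_q}) (n : 'Z_q -> nat).
Hypotheses (hq : (1 < q)%N) (hsigma : q_cycle sigma).
Hypothesis (hn : admissible sigma k n).

Let hk : (1 < k)%N. Proof. exact: admissible_degree hn. Qed.

(** Since (k-1) x_i = (x_(sigma i) - x_i) + e_i, the integer part is e_i or
    e_i - 1 according to the direction in which x_i moves. *)
Lemma solves_floor (x : 'Z_q -> R) (c : 'Z_q -> nat) :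
  (forall i, 0 < x i < 1) -> increasing x ->
  solves k sigma (fun i => c i + (rep (sigma i) < rep i))%N x ->
  forall i, (c i)%:R < k.-1%:R * x i < (c i)%:R + 1.
Proof.
move=> x01 xlt sx i; have := sx i; rewrite -{1}(prednK (ltnW hk)) -natr1 natrD.
have := x01 i; have := x01 (sigma i).
have [lt_si|] := ltnP (rep (sigma i)) (rep i).
  by have := xlt _ _ lt_si; rewrite /=; lra.
rewrite leq_eqVlt (inj_eq (rep_inj hq)) eq_sym (negPf (q_cycle_neq hsigma i)).
by move=> /= /xlt; lra.
Qed.

Definition orbit_of m : set R := range (point R sigma (code sigma n m) k).

Lemma point_code_solves m :
  solves k sigma (code sigma n m) (point R sigma (code sigma n m) k).
Proof. exact: point_solves. Qed.

Lemma orbit_of_labeling m : (m < n 0%R)%N ->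
  labeling (point R sigma (code sigma n m) k) (orbit_of m).
Proof.
move=> mn; have comp := code_compatible hq hsigma hn m.
have lt_k i := code_lt hq hsigma hn i mn.
split=> //; first exact: (solves_itv hq hk hsigma comp lt_k (point_code_solves m)).
exact: (solves_increasing hq hk hsigma comp lt_k (point_code_solves m)).
Qed.

Lemma orbit_of_floor m i : (m < n 0%R)%N ->
  (floors n m i)%:R < k.-1%:R * point R sigma (code sigma n m) k i
    < (floors n m i)%:R + 1.
Proof.
move=> mn; have [_ x01 xlt] := orbit_of_labeling mn.
exact: solves_floor (point_code_solves m) i.
Qed.

Lemma orbit_of_realization m : (m < n 0%R)%N -> realization k sigma (orbit_of m).
Proof.
move=> mn; have lab := orbit_of_labeling mn; have [_ x01 _] := lab.
set x := point _ _ _ _ in lab x01.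
have mapx i : mulmap k (x i) = x (sigma i).
  have /andP[xi0 _] := x01 i; have /andP[xs0 xs1] := x01 (sigma i).
  apply/mulmapP; rewrite ?(ltW xi0) ?(ltW xs0) ?xs1 //.
  by eexists; exact: point_code_solves.
have iterx l i : iter l (mulmap k) (x i) = x (iter l sigma i).
  by elim: l => //= l ->; rewrite mapx.
split; last by exists x.
exists (x 0); split.
- by have /andP[x0 ->] := x01 0; rewrite ltW.
- by rewrite iterx (q_cycle_order hq hsigma).
apply/seteqP; split=> [_ [i _ <-]|_ [l lq <-]].
  by have [l lq ->] := q_cycle_iter hq hsigma 0 i; exists l.
by rewrite iterx; exists (iter l sigma 0).
Qed.

Lemma orbit_of_fix m : (m < n 0%R)%N -> has_fix k (orbit_of m) n.
Proof.
move=> mn; have lab := orbit_of_labeling mn; have [_ x01 xlt] := lab.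
eexists; first exact: lab.
move=> i; have hc j := @orbit_of_floor m j mn.
have [->|i0] := eqVneq i 0; last first.
  by have := card_arc hq hk x01 xlt hc i0; rewrite floorsS // addKn.
have := card_arc0 hq hk x01 xlt hc; rewrite floors1 //.
have := floors0 n m hq; case: hn => -> _ _.
have : (m <= floors n m 0%R)%N by exact: leq_addr.
move: (floors n m 0) => c0 mc0 e0.
by rewrite (_ : (k.-1 - (c0 - m))%N = n 0) //; lia.
Qed.

Lemma orbit_of_fix_before m : (m < n 0%R)%N -> has_fix_before q k (orbit_of m) m.
Proof.
move=> mn; have lab := orbit_of_labeling mn; have [_ x01 xlt] := lab.
eexists; first exact: lab.
have := card_before hk x01 (fun j => @orbit_of_floor m j mn).
by rewrite floors1.
Qed.

(** The digits of a realization are forced: their floors increase by n_i on each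
    arc, so they are determined by n and by the value at index 1. *)
Lemma realization_orbit_of O : realization k sigma O -> has_fix k O n ->
  exists m, [/\ (m < n 0%R)%N, O = orbit_of m & has_fix_before q k O m].
Proof.
move=> [_ [x lab mapx]] [y /(labeling_unique hq lab) <- fixx].
have [Ox x01 xlt] := lab.
have /choice[e sx] : forall i, exists e : nat, k%:R * x i = x (sigma i) + e%:R.
  move=> i; have /andP[xi0 _] := x01 i; have /andP[xs0 xs1] := x01 (sigma i).
  by apply/mulmapP; rewrite ?(ltW xi0) ?(ltW xs0) ?xs1.
pose c i := (e i - (rep (sigma i) < rep i))%N.
have ec i : e i = (c i + (rep (sigma i) < rep i))%N.
  rewrite /c subnK //; case: ltnP => // /xlt xsi.
  (* With digit 0 the point would be multiplied by k > 1 and move right. *)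
  rewrite lt0n -(eqr_nat R); apply/eqP => ei0.
  have := sx i; have := x01 i; have : 1 < k%:R :> R by rewrite ltr1n.
  by rewrite ei0; nra.
have hc : forall i, (c i)%:R < k.-1%:R * x i < (c i)%:R + 1.
  by apply: solves_floor => // i; rewrite -ec.
have cS (i : 'Z_q) : i != 0 -> (c (i + 1)%R = c i + n i)%N.
  move=> i0; rewrite (card_II_unique (fixx i) (card_arc hq hk x01 xlt hc i0)).
  by rewrite subnKC // (floor_le hq hk xlt hc) // repS.
have n0 := card_II_unique (fixx 0) (card_arc0 hq hk x01 xlt hc).
have mn : (c 1%R < n 0%R)%N.
  have := @floor_le _ _ _ _ _ hq hk xlt hc 1 0; rewrite rep0 rep1 // n0.
  move=> /(_ (ltnW hq)); have := floor_lt_degree hk x01 hc 0.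
  by move: (c 0) (c 1) => a b; lia.
exists (c 1); split=> //; last by exists x => //; exact: card_before hk x01 hc.
rewrite Ox /orbit_of; suff -> : x = point R sigma (code sigma n (c 1)) k by [].
apply/funext; apply: (solves_unique hk _ (point_code_solves _)) => i.
by rewrite sx /code -(floors_unique hq cS) -ec.
Qed.

Lemma orbit_of_unique O m : realization k sigma O -> has_fix k O n ->
  has_fix_before q k O m -> O = orbit_of m.
Proof.
move=> rO fO [x labx cardm].
have [m' [_ Om [y laby cardm']]] := realization_orbit_of rO fO.
rewrite -(labeling_unique hq labx laby) in cardm'.
by rewrite Om (card_II_unique cardm cardm').
Qed.

(** The codes for m and 0 differ by the constant m, and
    k (m/(k-1)) = m/(k-1) + m, so the shifted solution solves the shifted
    system.  No reduction modulo 1 takes place, all points being in (0, 1). *)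
Lemma orbit_of_rotation m : (m < n 0%R)%N ->
  orbit_of m = [set modZ (y + m%:R / k.-1%:R) | y in orbit_of 0%N].
Proof.
move=> mn; have [_ x01 _] := orbit_of_labeling mn.
have k0 : k.-1%:R != 0 :> R by rewrite pnatr_eq0; lia.
have kE : k%:R = k.-1%:R + 1 :> R by rewrite natr1 prednK // ltnW.
have rot : point R sigma (code sigma n m) k
    =1 (fun i => point R sigma (code sigma n 0) k i + m%:R / k.-1%:R).
  apply: (solves_unique hk (point_code_solves m)) => i.
  rewrite mulrDr point_code_solves /code /floors add0n -addnA [in RHS]natrD.
  by rewrite kE mulrDl mulrCA mulfV // mulr1 mul1r; lra.
rewrite /orbit_of image_comp; apply: eq_imagel => i _ /=.
by rewrite -rot modZ_id //; have /andP[x0 ->] := x01 i; rewrite ltW.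
Qed.

End Realizations.

Theorem theorem7p2 (R : realType) (q : nat) (hq : (1 < q)%N)
    (sigma : {perm 'Z_q}) (hsigma : q_cycle sigma)
    (d k : nat) (hd : des sigma = d) (hk : (d < k)%N)
    (n : 'Z_q -> nat) (hn : admissible sigma k n) :
  [set O : set R | realization k sigma O /\ has_fix k O n] #= `I_(n 0%R) /\
  exists O_ : nat -> set R,
    (forall m : nat, (m < n 0%R)%N ->
       unique (fun O : set R => [/\ realization k sigma O, has_fix k O n
                                  & has_fix_before q k O m]) (O_ m)) /\
    (forall m : nat, (m < n 0%R)%N ->
       O_ m = [set modZ (y + m%:R / (k.-1)%:R) | y in O_ 0%N]).
Proof.
split.
  rewrite (_ : mkset _ = [set orbit_of k sigma n m | m in `I_(n 0%R)]).
    apply: inj_card_eq => m m'; rewrite !inE => mn mn' eO.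
    have [x labx cardm] := orbit_of_fix_before R hq hsigma hn mn.
    have [y laby cardm'] := orbit_of_fix_before R hq hsigma hn mn'.
    rewrite -eO in laby; rewrite -(labeling_unique hq labx laby) in cardm'.
    exact: card_II_unique cardm cardm'.
  apply/seteqP; split=> [O [rO fO]|_ [m mn <-]].
    by have [m [mn -> _]] := realization_orbit_of hq hsigma hn rO fO; exists m.
  by split; [exact: orbit_of_realization|exact: orbit_of_fix].
exists (orbit_of k sigma n); split=> m mn; last exact: orbit_of_rotation.
split=> [|O [rO fO bO]].
  by split; [exact: orbit_of_realization|exact: orbit_of_fix|
             exact: orbit_of_fix_before].
by rewrite -(orbit_of_unique hq hsigma hn rO fO bO).
Qed.
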